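(* Let $n\ge 1$ and let $S=\begin{pmatrix} A & B\\ C & D\end{pmatrix}\in A(2n,\mathbb{R})$, i.e. $S$ is a real $2n\times 2n$ matrix (with $n\times n$ blocks $A,B,C,D$) satisfying $S^tJS=-J$. Then the map $\Phi_S$, $\Phi_S(Z)=(AZ+B)(CZ+D)^{-1}$, maps $\mathcal{S}_n$ onto $\overline{\mathcal{S}}_n$.
   Context: $J=\begin{pmatrix} O & I_n\\ -I_n & O\end{pmatrix}$, where $I_n$ and $O$ are the $n\times n$ identity and zero matrices. $\mathcal{S}_n$ (the Siegel upper half space) is the set of complex $n\times n$ matrices $Z=X+iY$ with $X,Y$ real symmetric and $Y$ positive definite. $\overline{\mathcal{S}}_n$ is the set of complex $n\times n$ matrices $Z=X+iY$ with $X,Y$ real symmetric and $Y$ negative definite. The map $\Phi_S$ is well defined at $Z$ when $CZ+D$ is invertible; the assertion that $\Phi_S$ maps $\mathcal{S}_n$ onto $\overline{\mathcal{S}}_n$ includes that $CZ+D$ is invertible for every $Z\in\mathcal{S}_n$. *)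

(* Defs.v *)
From mathcomp Require Import all_boot all_order all_algebra.
From mathcomp Require Import classical_sets reals.
From mathcomp.real_closed Require Import complex.
Set Implicit Arguments.
Unset Strict Implicit.
Unset Printing Implicit Defensive.
Import Order.TTheory GRing.Theory Num.Theory.
Local Open Scope classical_set_scope.
Local Open Scope ring_scope.

Definition posdefmx (R : realType) (n : nat) (Y : 'M[R]_n) : Prop :=
  forall v : 'cV[R]_n, v != 0 -> 0 < (v^T *m Y *m v) 0 0.

Definition negdefmx (R : realType) (n : nat) (Y : 'M[R]_n) : Prop :=
  forall v : 'cV[R]_n, v != 0 -> (v^T *m Y *m v) 0 0 < 0.

Definition cplxmx (R : realType) (m n : nat) (M : 'M[R]_(m, n)) :
    'M[R[i]]_(m, n) :=
  map_mx (real_complex R) M.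

Definition siegel_upper (R : realType) (n : nat) : set 'M[R[i]]_n :=
  [set Z | exists X Y : 'M[R]_n,
    [/\ Z = cplxmx X + 'i%C *: cplxmx Y,
        X \is symmetricmx, Y \is symmetricmx & posdefmx Y]].

Definition siegel_lower (R : realType) (n : nat) : set 'M[R[i]]_n :=
  [set Z | exists X Y : 'M[R]_n,
    [/\ Z = cplxmx X + 'i%C *: cplxmx Y,
        X \is symmetricmx, Y \is symmetricmx & negdefmx Y]].

Definition Jmx (R : realType) (n : nat) : 'M[R]_(n + n) :=
  block_mx 0 1%:M (- 1%:M) 0.

Definition antisymplectic (R : realType) (n : nat) : set 'M[R]_(n + n) :=
  [set S | S^T *m Jmx R n *m S = - Jmx R n].

Definition Phi_num (R : realType) (n : nat) (S : 'M[R]_(n + n))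
    (Z : 'M[R[i]]_n) : 'M[R[i]]_n :=
  cplxmx (ulsubmx S) *m Z + cplxmx (ursubmx S).

Definition Phi_den (R : realType) (n : nat) (S : 'M[R]_(n + n))
    (Z : 'M[R[i]]_n) : 'M[R[i]]_n :=
  cplxmx (dlsubmx S) *m Z + cplxmx (drsubmx S).

(* [invmx M] is [M] itself when [M] is singular, so this is the
   fractional-linear map only where [Phi_den S Z \in unitmx]. *)
Definition Phi (R : realType) (n : nat) (S : 'M[R]_(n + n))
    (Z : 'M[R[i]]_n) : 'M[R[i]]_n :=
  Phi_num S Z *m invmx (Phi_den S Z).

Arguments siegel_upper : clear implicits.
Arguments siegel_lower : clear implicits.
Arguments antisymplectic : clear implicits.

(* Main.v *)
Require Import Defs.
From mathcomp Require Import all_boot all_order all_algebra.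
From mathcomp Require Import classical_sets reals.
From mathcomp.real_closed Require Import complex.
Set Implicit Arguments.
Unset Strict Implicit.
Unset Printing Implicit Defensive.
Import Order.TTheory GRing.Theory Num.Theory.
Local Open Scope classical_set_scope.
Local Open Scope ring_scope.

(** Write [W] for the stacked matrix [col_mx Z 1].  The product [S W] is
    [col_mx P Q] with [P = A Z + B] and [Q = C Z + D], and [Phi_S Z] is the
    matrix [M] for which [col_mx M 1] spans the same columns.  The relation
    [S^T J S = - J] says that [S] changes the sign of the pairing
    [W^T J W = Z^T - Z] and, [S] being real, also of the pairing
    [W^* J W = Z^* - Z].  So
      - [P^T Q - Q^T P = Z - Z^T] and [P^* Q - Q^* P = Z - Z^*].
    The first identity carries symmetry from [Z] to [P Q^-1].  For symmetric
    [Z] with imaginary part [Y], [Z^* - Z] is [- 2 i Y], so the second identity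
    shows that a vector in the kernel of [Q] is isotropic for the definite
    form [Y] and hence zero, and that the imaginary part of [P Q^-1] is
    [- (Q^-1)^* Y Q^-1], definite of the opposite sign.

    The argument is uniform in the sign of [Y]: an element of the group
    exchanges the two half spaces in both directions
    ([halfspace_den_unit], [halfspace_Phi]).  Surjectivity follows because
    [S^-1] satisfies the same relation, and [Phi_S] inverts [Phi_(S^-1)]
    ([PhiK]). *)

(** * Twisted transposes and the symplectic pairing *)

(** Transposition twisted by a field endomorphism: the twist [id] gives
    the transpose and [conjc] the conjugate transpose, so that
    the bilinear and sesquilinear identities are proved together. *)
Definition twtr {R : realType} (f : R[i] -> R[i]) {m n : nat}
  (A : 'M[R[i]]_(m, n)) : 'M[R[i]]_(n, m) := (map_mx f A)^T.

Notation "A ^dag" := (twtr conjc A) (at level 8, format "A ^dag").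

Section TwistedTranspose.

Variables (R : realType) (f : {rmorphism R[i] -> R[i]}).
Implicit Types m n p : nat.

Lemma twtrM m n p (A : 'M[R[i]]_(m, n)) (B : 'M_(n, p)) :
  twtr f (A *m B) = twtr f B *m twtr f A.
Proof. by rewrite /twtr map_mxM trmx_mul. Qed.

Lemma twtr1 n : twtr f 1%:M = 1%:M :> 'M_n.
Proof. by rewrite /twtr map_mx1 trmx1. Qed.

Lemma twtr_col m1 m2 n (A : 'M_(m1, n)) (B : 'M_(m2, n)) :
  twtr f (col_mx A B) = row_mx (twtr f A) (twtr f B).
Proof. by rewrite /twtr map_col_mx tr_col_mx. Qed.

Lemma pairing_col n (A B : 'M[R[i]]_n) :
  twtr f (col_mx A B) *m cplxmx (Jmx R n) *m col_mx A B
  = twtr f A *m B - twtr f B *m A.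
Proof.
rewrite twtr_col /cplxmx /Jmx map_block_mx !map_mx0 map_mxN map_mx1.
rewrite mul_row_block mul_row_col !mulmx0 add0r addr0 mulmx1.
by rewrite mulmxN mulmx1 mulNmx addrC.
Qed.

Lemma graph_Phi n (S : 'M[R]_(n + n)) (Z : 'M_n) :
  cplxmx S *m col_mx Z 1%:M = col_mx (Phi_num S Z) (Phi_den S Z).
Proof.
rewrite -{1}(submxK S) /cplxmx map_block_mx mul_block_col !mulmx1.
by rewrite /Phi_num /Phi_den.
Qed.

Hypothesis f_real : forall x : R, f x%:C%C = x%:C%C.

Lemma twtr_cplx m n (A : 'M[R]_(m, n)) : twtr f (cplxmx A) = cplxmx A^T.
Proof. by apply/matrixP=> i j; rewrite !mxE f_real. Qed.

Lemma pairing_Phi n (S : 'M[R]_(n + n)) (Z : 'M_n) :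
  antisymplectic R n S ->
  twtr f (Phi_num S Z) *m Phi_den S Z - twtr f (Phi_den S Z) *m Phi_num S Z
  = Z - twtr f Z.
Proof.
move=> HS; rewrite -pairing_col -graph_Phi twtrM twtr_cplx.
have -> : twtr f (col_mx Z 1%:M) *m cplxmx S^T *m cplxmx (Jmx R n)
    *m (cplxmx S *m col_mx Z 1%:M)
  = twtr f (col_mx Z 1%:M) *m cplxmx (S^T *m Jmx R n *m S) *m col_mx Z 1%:M.
  by rewrite /cplxmx !map_mxM !mulmxA.
rewrite HS /cplxmx map_mxN mulmxN mulNmx pairing_col.
by rewrite twtr1 mulmx1 mul1mx opprB.
Qed.

End TwistedTranspose.

(** * The two half spaces through the complex form of the imaginary part *)

(** For symmetric [Z] the matrix ['i (Z^* - Z)] is twice the imaginary part.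
    Testing it on complex vectors lets the substitution [v := Q^-1 v], with [Q]
    complex, act on the form. *)
Definition imform {R : realType} {n : nat} (Z : 'M[R[i]]_n) (v : 'cV_n)
  : R[i] := (v^dag *m ('i%C *: (Z^dag - Z)) *m v) 0 0.

(** The sign [e] is [1] for the upper half space and [-1] for the lower one. *)
Definition halfspace {R : realType} {n : nat} (e : R) (Z : 'M[R[i]]_n) : Prop :=
  Z^T = Z /\ forall v : 'cV[R[i]]_n, v != 0 -> 0 < e%:C%C * imform Z v.

Section HalfSpaces.

Variable R : realType.
Implicit Types (m n : nat) (e : R).

Lemma cplxmx_decomp m n (A : 'M[R[i]]_(m, n)) :
  A = cplxmx (map_mx (@complex.Re R) A) + 'i%C *: cplxmx (map_mx (@complex.Im R) A).
Proof. by apply/matrixP=> i j; rewrite !mxE -complexE. Qed.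

Lemma dag_decomp m n (X Y : 'M[R]_(m, n)) :
  (cplxmx X + 'i%C *: cplxmx Y)^dag = cplxmx X^T - 'i%C *: cplxmx Y^T.
Proof.
apply/matrixP=> i j; rewrite !mxE; apply/eqP; rewrite eq_complex /=.
by rewrite !(mul0r, mul1r, subr0, addr0, add0r, oppr0) !eqxx.
Qed.

Lemma imform_decomp n (X Y : 'M[R]_n) (a b : 'cV[R]_n) :
  X^T = X -> Y^T = Y ->
  imform (cplxmx X + 'i%C *: cplxmx Y) (cplxmx a + 'i%C *: cplxmx b)
  = (2 * ((a^T *m Y *m a) 0 0 + (b^T *m Y *m b) 0 0))%:C%C.
Proof.
move=> Xs Ys; rewrite /imform !dag_decomp Xs Ys.
have ii : 'i%C * 'i%C = -1 :> R[i] by rewrite -expr2 sqr_i.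
have -> : 'i%C *: (cplxmx X - 'i%C *: cplxmx Y - (cplxmx X + 'i%C *: cplxmx Y))
    = 2 *: cplxmx Y.
  rewrite opprD addrACA subrr add0r -opprD -scalerDl scalerN scalerA mulrDr ii.
  by rewrite -opprD -[1 + 1]/(2%:R) scaleNr opprK.
(* The cross terms cancel because the symmetric form takes the same value
   on (a, b) and (b, a). *)
have cross : b^T *m Y *m a = a^T *m Y *m b.
  rewrite -[LHS]trmxK [in LHS](_ : (b^T *m Y *m a)^T = a^T *m Y *m b).
    by apply/matrixP=> i j; rewrite !ord1 mxE.
  by rewrite !trmx_mul trmxK Ys mulmxA.
have -> : (cplxmx a^T - 'i%C *: cplxmx b^T) *m (2 *: cplxmx Y)
      *m (cplxmx a + 'i%C *: cplxmx b)
    = 2 *: (cplxmx (a^T *m Y *m a) + cplxmx (b^T *m Y *m b)).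
  rewrite -scalemxAr -scalemxAl; congr (_ *: _).
  rewrite !mulmxBl !mulmxDr -!scalemxAl -!scalemxAr scalerA ii.
  rewrite /cplxmx -!map_mxM cross scaleN1r.
  by rewrite opprD opprK addrA addrK.
by rewrite !mxE -rmorphD -(rmorph_nat (real_complex R) 2) -rmorphM.
Qed.

Lemma cplx_vec_neq0 n (a b : 'cV[R]_n) :
  (cplxmx a + 'i%C *: cplxmx b != 0) = (a != 0) || (b != 0).
Proof.
rewrite -negb_and; congr (~~ _); apply/eqP/andP=> [/matrixP H|[/eqP-> /eqP->]].
  split; apply/eqP/matrixP=> i j; have /eqP := H i j; rewrite !mxE;
    by rewrite eq_complex /= !(mul0r, mul1r, subr0, addr0, add0r) => /andP[/eqP ? /eqP ?].
by rewrite /cplxmx !map_mx0 scaler0 addr0.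
Qed.

(** On [a + i b] the complex form is twice the sum of the values of the real
    form at [a] and [b], so definiteness on real vectors and on complex vectors
    agree. *)
Lemma halfspaceP n e (Z : 'M[R[i]]_n) :
  halfspace e Z <->
  exists X Y : 'M[R]_n, [/\ Z = cplxmx X + 'i%C *: cplxmx Y,
    X \is symmetricmx, Y \is symmetricmx &
    forall v : 'cV_n, v != 0 -> 0 < e * (v^T *m Y *m v) 0 0].
Proof.
have symE (A : 'M[R]_n) : (A \is symmetricmx) = (A^T == A).
  by rewrite qualifE /= expr0 scale1r map_mx_id // eq_sym.
split=> [[Zs Zpos]|[X [Y [-> Xs Ys Ypos]]]].
  have imE := cplxmx_decomp Z.
  set X := map_mx _ Z in imE; set Y := map_mx (@complex.Im R) Z in imE.
  have Xs : X^T = X by rewrite /X map_trmx Zs.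
  have Ys : Y^T = Y by rewrite /Y map_trmx Zs.
  exists X, Y; split; rewrite ?symE ?Xs ?Ys // => v v0.
  have := Zpos (cplxmx v + 'i%C *: cplxmx 0).
  rewrite cplx_vec_neq0 v0 {1}imE imform_decomp // => /(_ isT).
  rewrite mulmx0 [in X in _ + X]mxE addr0 -rmorphM /= ltcR mulrCA.
  by rewrite pmulr_rgt0 // ltr0n.
move: Xs Ys; rewrite !symE => /eqP Xs /eqP Ys; split.
  by rewrite linearD linearZ /= /cplxmx !map_trmx Xs Ys.
move=> v; rewrite (cplxmx_decomp v) cplx_vec_neq0 imform_decomp //.
set a := map_mx _ v; set b := map_mx _ v => ab0.
rewrite -rmorphM /= ltcR mulrCA pmulr_rgt0 ?ltr0n // mulrDr.
have nonneg (w : 'cV[R]_n) : 0 <= e * (w^T *m Y *m w) 0 0.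
  by have [->|/Ypos/ltW//] := eqVneq w 0; rewrite mulmx0 mxE mulr0.
by case/orP: ab0 => /Ypos ?; [rewrite ltr_wpDr|rewrite ltr_wpDl].
Qed.

Lemma siegel_upperP n (Z : 'M[R[i]]_n) : siegel_upper R n Z <-> halfspace 1 Z.
Proof.
rewrite halfspaceP; split=> -[X [Y [ZE Xs Ys Yp]]]; exists X, Y; split=> // v.
  by rewrite mul1r; apply: Yp.
by move=> /Yp; rewrite mul1r.
Qed.

Lemma siegel_lowerP n (Z : 'M[R[i]]_n) :
  siegel_lower R n Z <-> halfspace (-1) Z.
Proof.
rewrite halfspaceP; split=> -[X [Y [ZE Xs Ys Yp]]]; exists X, Y; split=> // v.
  by rewrite mulN1r oppr_gt0; apply: Yp.
by move=> /Yp; rewrite mulN1r oppr_gt0.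
Qed.

(** Congruence by [Q], written so that [M] and [Q] enter the middle matrix only
    through [M Q] and [Q]. *)
Lemma imform_congr n (M Q : 'M[R[i]]_n) (v : 'cV_n) :
  imform M (Q *m v)
  = (v^dag *m ('i%C *: ((M *m Q)^dag *m Q - Q^dag *m (M *m Q))) *m v) 0 0.
Proof.
rewrite /imform !(twtrM (@conjc R)); congr (fun_of_matrix _ 0 0).
rewrite -!scalemxAr -!scalemxAl; congr (_ *: _).
by rewrite !mulmxBr !mulmxBl !mulmxA.
Qed.

End HalfSpaces.

(** * The action of the group *)

Section Action.

Variables (R : realType) (n : nat).
Implicit Types (S : 'M[R]_(n + n)) (Z : 'M[R[i]]_n) (e : R).

Let pairing_tr S Z : antisymplectic R n S ->
  (Phi_num S Z)^T *m Phi_den S Z - (Phi_den S Z)^T *m Phi_num S Z = Z - Z^T.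
Proof.
move=> /(@pairing_Phi R idfun (fun=> erefl) n S Z).
by rewrite /twtr !map_mx_id.
Qed.

Let pairing_dag S Z : antisymplectic R n S ->
  (Phi_num S Z)^dag *m Phi_den S Z - (Phi_den S Z)^dag *m Phi_num S Z
  = Z - Z^dag.
Proof. exact: (@pairing_Phi R (@conjc R) (@conjc_real R)). Qed.

(** A vector [v] killed by the denominator [Q] is isotropic for
    [P^* Q - Q^* P = Z - Z^*], which definiteness forbids unless [v = 0]. *)
Lemma halfspace_den_unit S Z e :
  antisymplectic R n S -> halfspace e Z -> Phi_den S Z \in unitmx.
Proof.
move=> HS [_ Zpos]; rewrite -unitmx_tr -row_free_unit -kermx_eq0.
apply/eqP/row_matrixP=> i; rewrite row0; apply/eqP/negPn/negP=> v0.
set u := row i _ in v0; set v := u^T.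
have Qv : Phi_den S Z *m v = 0.
  apply: trmx_inj; rewrite trmx_mul trmxK trmx0 /u.
  by rewrite -row_mul mulmx_ker row0.
have /Zpos : v != 0 by rewrite -trmx0 (inj_eq trmx_inj).
suff -> : imform Z v = 0 by rewrite mulr0 ltxx.
rewrite /imform -opprB -(pairing_dag _ HS) scalerN mulmxN -scalemxAr.
rewrite mulNmx -scalemxAl mulmxBr mulmxBl -!mulmxA Qv !mulmx0 sub0r !mulmxA.
have -> : v^dag *m (Phi_den S Z)^dag = 0.
  by rewrite -(twtrM (@conjc R)) Qv /twtr map_mx0 trmx0.
by rewrite !mul0mx oppr0 scaler0 oppr0 mxE.
Qed.

(** The imaginary part of [P Q^-1] at [w] is minus that of [Z] at [Q^-1 w]. *)
Lemma halfspace_Phi S Z e : antisymplectic R n S -> halfspace e Z ->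
  halfspace (- e) (Phi S Z).
Proof.
move=> HS HZ; have Qu := halfspace_den_unit HS HZ; case: HZ => Zs Zpos.
have PQ := pairing_tr Z HS; have PQd := pairing_dag Z HS.
rewrite /Phi; set P := Phi_num S Z in PQ PQd *.
set Q := Phi_den S Z in Qu PQ PQd *; set M := P *m invmx Q.
have MQ : M *m Q = P by rewrite mulmxKV.
have QTu : Q^T \in unitmx by rewrite unitmx_tr.
split.
  move: PQ; rewrite Zs subrr -MQ trmx_mul => /eqP; rewrite subr_eq0 => /eqP H.
  apply: (can_inj (mulKmx QTu)); apply: (can_inj (mulmxK Qu)).
  by rewrite H mulmxA.
move=> w w0; set v := invmx Q *m w.
have wE : w = Q *m v by rewrite mulKVmx.
have v0 : v != 0 by apply: contraNneq w0; rewrite wE => ->; rewrite mulmx0.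
suff -> : imform M w = - imform Z v.
  by rewrite rmorphN /= mulrNN; apply: Zpos.
rewrite wE imform_congr MQ PQd /imform -[Z - _]opprB scalerN.
by rewrite mulmxN mulNmx mxE.
Qed.

(** As [J^2 = -1], the defining relation multiplied by [J] on the left reads
    [(J S^T J) S = 1]. *)
Lemma antisymplectic_mulJ S : antisymplectic R n S ->
  S *m (Jmx R n *m S^T *m Jmx R n) = 1%:M.
Proof.
move=> HS; apply: mulmx1C.
have JJ : Jmx R n *m Jmx R n = - 1%:M.
  rewrite /Jmx mulmx_block !(mulmx0, mul0mx, mulmxN, mulmx1, add0r, addr0).
  by rewrite scalar_mx_block opp_block_mx oppr0.
by rewrite -!mulmxA (mulmxA S^T) HS mulmxN JJ opprK.
Qed.

Lemma antisymplectic_inv S : antisymplectic R n S ->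
  exists2 T, antisymplectic R n T & S *m T = 1%:M.
Proof.
move=> HS; have [T ST] : exists T, S *m T = 1%:M.
  by exists (Jmx R n *m S^T *m Jmx R n); apply: antisymplectic_mulJ.
exists T => //.
have TS : T^T *m S^T = 1%:M by rewrite -trmx_mul ST trmx1.
change (T^T *m Jmx R n *m T = - Jmx R n).
have -> : T^T *m Jmx R n *m T = - (T^T *m (S^T *m Jmx R n *m S) *m T).
  by rewrite HS mulmxN mulNmx opprK.
by rewrite !mulmxA TS mul1mx -mulmxA ST mulmx1.
Qed.

(** [col_mx (Phi_T Z) 1] is [T (col_mx Z 1)] up to the right factor [Q^-1];
    applying [S] therefore returns [col_mx Z 1] times the same factor, which
    cancels in the quotient. *)
Lemma PhiK S T Z : S *m T = 1%:M -> Phi_den T Z \in unitmx ->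
  Phi S (Phi T Z) = Z.
Proof.
move=> ST Qu; set Q := Phi_den T Z in Qu.
have /eq_col_mx[numE denE] :
    col_mx (Phi_num S (Phi T Z)) (Phi_den S (Phi T Z))
    = col_mx (Z *m invmx Q) (invmx Q).
  rewrite -graph_Phi -{1}(mulmxV Qu) -mul_col_mx -graph_Phi.
  rewrite !mulmxA /cplxmx -map_mxM ST map_mx1 mul1mx.
  by rewrite mul_col_mx mul1mx.
by rewrite /Phi numE denE invmxK mulmxKV.
Qed.

End Action.

Theorem proposition2p1 (R : realType) (n : nat) (n_gt0 : (0 < n)%N)
    (S : 'M[R]_(n + n)) (HS : antisymplectic R n S) :
  (forall Z : 'M[R[i]]_n, siegel_upper R n Z -> Phi_den S Z \in unitmx) /\
  Phi S @` siegel_upper R n = siegel_lower R n.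
Proof.
split=> [Z /siegel_upperP|]; first exact: halfspace_den_unit.
apply/seteqP; split=> [_ [Z /siegel_upperP HZ <-]|W /siegel_lowerP HW].
  by apply/siegel_lowerP; apply: halfspace_Phi.
have [T HT ST] := antisymplectic_inv HS.
exists (Phi T W); last exact: PhiK ST (halfspace_den_unit HT HW).
by apply/siegel_upperP; rewrite -[1]opprK; apply: halfspace_Phi.
Qed.
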